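(* For any prime $p$, we have $$\lim_{m \to \infty} \frac{\sum_{k=1}^m \phi(pk)}{(pm)^2}=\frac{3}{(p+1)\pi^2}.$$
   Context: $\phi$ denotes Euler's totient function: $\phi(n)$ is the number of positive integers not exceeding $n$ that are relatively prime to $n$ (so $\phi(1)=1$). The limit is over positive integers $m$. *)

(* Defs.v *)
From mathcomp Require Import all_boot all_order all_algebra.
(* [totient] is defined in mathcomp's prime.v through the prime factorisation
   of its argument; [totient_count_coprime] identifies it with the number of
   d < n coprime to n, which for every n > 0 is the same count as over
   1 <= d <= n (for n > 1 neither 0 nor n is coprime to n; for n = 1 both
   counts are 1). *)

(* Main.v *)
Require Import Defs.
From mathcomp Require Import all_boot all_order all_algebra.
From mathcomp Require Import all_classical all_reals all_analysis.
From mathcomp Require Import cyclic ring lra.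
Import Order.TTheory GRing.Theory Num.Theory.
Import numFieldNormedType.Exports.
Local Open Scope classical_set_scope.
Local Open Scope ring_scope.

(** The proof avoids the Moebius function. Write $S(m) = \sum_{k \le m} \phi(k)$
and $F(m) = \sum_{k \le m} \phi(pk)$. Each satisfies an exact self-similar
recurrence:
- $\sum_{d \le m} S(\lfloor m/d \rfloor) = m(m+1)/2$, which is Gauss's identity
  $\sum_{d | n} \phi(d) = n$ summed over $n \le m$ ([totient_sum_floor]);
- $F(m) = (p-1) S(m) + F(\lfloor m/p \rfloor)$, because $\phi(pk)$ is
  $(p-1)\phi(k)$, plus a second $\phi(k)$ when $p | k$ ([totient_sum_prime]).

If $S(m) \sim L m^2$ then the first recurrence forces $L \zeta(2) = 1/2$, that is
$L = 3/\pi^2$; if $F(m) \sim G m^2$ then the second forces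
$G = (p-1) L + G/p^2$, that is $G = L p^2/(p+1)$. Dividing by $p^2$ gives the
announced limit.

That these asymptotics do hold is a contraction argument
([subquadratic_contraction]). The error $w(m) = |S(m) - L m^2|$ satisfies
$w(m) \le r(m) + \sum_{2 \le d \le m} w(\lfloor m/d \rfloor)$ with $r(m) = o(m^2)$.
A bound $w(m) \le A m^2$ thus improves to $(\zeta(2) - 1) A m^2 + o(m^2)$, and
$\zeta(2) - 1 \le 3/4 < 1$, so iterating yields $w(m) = o(m^2)$. The error of $F$
obeys the same inequality, its recurrence having the single term $d = p$.

The value $\zeta(2) = \pi^2/6$ enters through $r$. It is obtained from the closed
form of $\sum_{0 < k < N} \sin^{-2}(k\pi/2N)$ for $N$ a power of two, together
with $x^{-2} \le \sin^{-2} x \le x^{-2} + 1$ on $(0, \pi/2)$ ([zeta2_sum_basel]). *)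

(** * Recurrences for the summatory totient *)

Definition totient_sum (p m : nat) : nat :=
  (\sum_(1 <= k < m.+1) totient (p * k))%N.

(** Both sides sum $f(k)$ over the lattice points $d, k \ge 1$ under the hyperbola
$dk \le m$, grouped by $d$ on the left and by $k$ on the right. *)
Lemma sum_sum_floor (f : nat -> nat) (m : nat) :
  (\sum_(1 <= d < m.+1) \sum_(1 <= k < (m %/ d).+1) f k
    = \sum_(1 <= k < m.+1) f k * (m %/ k))%N.
Proof.
transitivity (\sum_(1 <= d < m.+1) \sum_(1 <= k < m.+1 | k * d <= m) f k)%N.
  apply: eq_big_nat => d /andP[d0 _].
  rewrite (big_nat_widen _ _ m.+1); last by rewrite ltnS leq_div.
  by apply: eq_bigl => k; rewrite ltnS leq_divRL.
rewrite (exchange_big_dep predT)//=.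
apply: eq_big_nat => k /andP[k0 _].
transitivity (\sum_(1 <= d < (m %/ k).+1) f k)%N.
  rewrite [RHS](big_nat_widen _ _ m.+1); last by rewrite ltnS leq_div.
  by apply: eq_bigl => d; rewrite ltnS leq_divRL// mulnC.
by rewrite sum_nat_const_nat subn1 mulnC.
Qed.

(** Passing from $m$ to $m+1$ raises $\lfloor m/k \rfloor$ by one exactly when
$k | m+1$, so the left side grows by $\sum_{k | m+1} \phi(k) = m+1$. *)
Lemma sum_totient_floor (m : nat) :
  (\sum_(1 <= k < m.+1) totient k * (m %/ k) = \sum_(1 <= n < m.+1) n)%N.
Proof.
elim: m => [|m IH]; first by rewrite !big_geq.
rewrite [RHS]big_nat_recr//= -IH.
have -> : (\sum_(1 <= k < m.+2) totient k * (m.+1 %/ k) =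
    \sum_(1 <= k < m.+2) totient k * (m %/ k) +
    \sum_(1 <= k < m.+2) totient k * (k %| m.+1))%N.
  rewrite -big_split/=; apply: eq_big_nat => k /andP[k0 _].
  by rewrite divnS// mulnDr addnC.
congr addn; first by rewrite big_nat_recr//= divn_small// muln0 addn0.
rewrite -[RHS]sum_totient_dvd -(big_mkord (fun d => d %| m.+1)%N totient).
rewrite [RHS]big_mkcond [RHS]big_ltn//= add0n.
by apply: eq_bigr => k _; case: (k %| _)%N; rewrite ?muln1 ?muln0.
Qed.

Lemma totient_sum_floor (m : nat) :
  (\sum_(1 <= d < m.+1) totient_sum 1 (m %/ d) = \sum_(1 <= n < m.+1) n)%N.
Proof.
rewrite -sum_totient_floor -sum_sum_floor.
by apply: eq_bigr => d _; apply: eq_bigr => k _; rewrite mul1n.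
Qed.

Lemma totient_prime_mul (p n : nat) : prime p -> (0 < n)%N ->
  totient (p * n) = (p.-1 * totient n + (p %| n) * totient n)%N.
Proof.
move=> pp n0; have [pn|pn] := boolP (p %| n)%N.
  have [k Npk ->] := pfactor_coprime pp n0.
  have : (0 < logn p n)%N by rewrite logn_gt0 mem_primes pp n0.
  case: (logn p n) => // e _.
  rewrite mulnCA -expnS !(@totient_coprime k) ?coprimeXr 1?coprime_sym//.
  rewrite !totient_pfactor// [e.+2.-1]/= expnS/=; have := prime_gt0 pp.
  by case: p {pp pn Npk} => //= p _; ring.
by rewrite totient_coprime ?prime_coprime// totient_prime// mul0n addn0.
Qed.

(** The multiples of $p$ up to $m$ are the $pj$ with $j \le \lfloor m/p \rfloor$, so the
extra $\phi(k)$ that appears when $p | k$ sums up to the same function at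
$\lfloor m/p \rfloor$. *)
Lemma totient_sum_prime (p m : nat) : prime p ->
  totient_sum p m = (p.-1 * totient_sum 1 m + totient_sum p (m %/ p))%N.
Proof.
move=> pp; have p0 := prime_gt0 pp; rewrite /totient_sum.
elim: m => [|m IH]; first by rewrite div0n !big_geq// muln0.
rewrite !(big_nat_recr m.+1)//= IH mul1n divnS// totient_prime_mul//.
have [/dvdnP[q qE]|_] := boolP (p %| m.+1)%N; last by rewrite add0n mul0n; ring.
have qm : (m %/ p).+1 = q.
  by have := divnS m p0; rewrite qE mulnK// dvdn_mull// add1n.
rewrite add1n [in RHS](big_nat_recr (m %/ p).+1)//=. 
  by rewrite qm (mulnC p q) -qE; ring.
Qed.

Lemma totient_le (n : nat) : (totient n <= n)%N.
Proof.
rewrite totient_count_coprime -[leqRHS]subn0 -[leqRHS]muln1 -sum_nat_const_nat.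
by apply: leq_sum => d _; exact: leq_b1.
Qed.

Lemma totient_sum_le (p m : nat) : (totient_sum p m <= p * m ^ 2)%N.
Proof.
rewrite /totient_sum (@leq_trans (\sum_(1 <= k < m.+1) p * m))//.
  rewrite !big_nat; apply: leq_sum => k /andP[_ km].
  by rewrite (leq_trans (totient_le _))// leq_mul.
by rewrite sum_nat_const_nat subn1/= mulnCA expnS expn1.
Qed.

(** * The value of zeta(2) *)

(** The inequalities $\sin x \le x \le \tan x$, squared and inverted, since
$\sin^{-2} x = \tan^{-2} x + 1$. *)
Lemma inv_sqr_sin_bounds (R : realType) (x : R) : 0 < x < pi / 2 ->
  x ^- 2 <= (sin x) ^- 2 <= x ^- 2 + 1.
Proof.
move=> /andP[x0 xpi].
have xI : 0 < x < pi / 2 by rewrite x0.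
have cosy y : y \in `[0, x] -> 0 < cos y.
  rewrite in_itv/= => /andP[y0 yx]; apply: cos_gt0_pihalf.
  by rewrite (le_lt_trans yx xpi) andbT (lt_le_trans _ y0)// oppr_lt0 (lt_trans x0).
have cosy_neq0 y : y \in `[0, x] -> cos y != 0 by move/cosy/gt_eqF/negbT.
have sinx0 : 0 < sin x by apply: sin_gt0_pihalf.
have cosx0 : 0 < cos x by rewrite cosy// in_itv/= lexx ltW.
have sin_le : sin x <= x.
  have [c _] := MVT x0 (fun y _ => is_derive_sin y)
    (continuous_subspaceT (@continuous_sin R)).
  rewrite sin0 !subr0 => ->; rewrite ler_piMl ?(ltW x0)// cos_le1.
have le_tan : x <= tan x.
  have [||c cI] := @MVT _ tan (fun y => (cos y) ^- 2) 0 x x0.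
  - move=> y /subset_itv_oo_cc yI.
    exact/is_derive_tan/cosy_neq0.
  - by apply: derivable_within_continuous => y /cosy_neq0; exact: derivable_tan.
  - rewrite tan0 !subr0 => ->; rewrite ler_peMl ?(ltW x0)//.
    have c0 := cosy _ (subset_itv_oo_cc cI).
    by rewrite invf_ge1 ?exprn_gt0// exprn_ile1// ?cos_le1// ltW.
have tanx0 : 0 < tan x by rewrite divr_gt0.
apply/andP; split.
  by rewrite lef_pV2 ?posrE ?exprn_gt0// lerXn2r// nnegrE ltW.
have -> : (sin x) ^- 2 = (tan x) ^- 2 + 1.
  rewrite /tan; have := cos2Dsin2 x.
  have -> : (sin x / cos x) ^- 2 + 1 = (cos x ^+ 2 + sin x ^+ 2) / sin x ^+ 2.
    by field; rewrite !gt_eqF.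
  by move=> ->; rewrite mul1r.
by rewrite lerD2r lef_pV2 ?posrE ?exprn_gt0// lerXn2r// nnegrE ltW.
Qed.

Definition inv_sqr_sin_sum (R : realType) (N : nat) : R :=
  \sum_(1 <= k < N) (sin (k%:R * (pi / 2) / N%:R)) ^- 2.

Lemma inv_sqr_sin_half (R : realType) (x : R) : sin x != 0 -> cos x != 0 ->
  (sin x) ^- 2 + (cos x) ^- 2 = 4 * (sin (x *+ 2)) ^- 2.
Proof.
move=> s0 c0; rewrite sin_mulr2n.
have -> : (sin x) ^- 2 + (cos x) ^- 2 =
    (cos x ^+ 2 + sin x ^+ 2) / (sin x ^+ 2 * cos x ^+ 2).
  by field; rewrite s0 c0.
by rewrite cos2Dsin2; field; rewrite s0 c0.
Qed.

Lemma grid_bounds (R : realType) (k N : nat) : (0 < k < N)%N ->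
  0 < (k%:R * (pi / 2) / N%:R : R) < pi / 2.
Proof.
move=> /andP[k0 kN].
have N0 : 0 < N%:R :> R by rewrite ltr0n (leq_trans _ kN).
have p0 : 0 < pi / 2 :> R by rewrite divr_gt0 ?pi_gt0.
apply/andP; split; first by rewrite divr_gt0// mulr_gt0// ltr0n.
by rewrite ltr_pdivrMr// [ltRHS]mulrC ltr_pM2r// ltr_nat.
Qed.

(** The points of the grid of $2N$ other than $\pi/4$ pair up as $x$ and
$\pi/2 - x$ with $x = k\pi/4N$, $k < N$. By [inv_sqr_sin_half] each pair contributes
$\sin^{-2} x + \cos^{-2} x = 4 \sin^{-2}(2x)$, a term of the grid of $N$, while the
midpoint contributes $2$. *)
Lemma inv_sqr_sin_sum_double (R : realType) (N : nat) : (0 < N)%N ->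
  inv_sqr_sin_sum R N.*2 = 4 * inv_sqr_sin_sum R N + 2.
Proof.
move=> N0; rewrite /inv_sqr_sin_sum.
have NR : (N%:R : R) != 0 by rewrite pnatr_eq0 -lt0n.
have N2 : (N.*2%:R : R) = N%:R * 2 by rewrite -muln2 natrM.
rewrite (@big_cat_nat _ _ _ N)//=; last by rewrite -addnn leq_addr.
(* Isolate the midpoint k = N, that is the angle pi/4. *)
rewrite (@big_ltn _ _ _ N)/=; last by rewrite -addnn -[ltnLHS]addn0 ltn_add2l.
have -> : sin (N%:R * (pi / 2) / N.*2%:R) ^- 2 = 2 :> R.
  have -> : N%:R * (pi / 2) / N.*2%:R = pi / 4 :> R by rewrite N2; field.
  have c0 : 0 < cos (pi / 4 : R) by apply: cos_gt0_pihalf; have := pi_gt0 R; lra.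
  have /(congr1 ( *%R^~ (cos (pi / 4)))) := tan_piquarter R.
  rewrite /tan mulfVK ?gt_eqF// mul1r => sc; have := cos2Dsin2 (pi / 4 : R).
  rewrite -sc => sE; have -> : sin (pi / 4) ^+ 2 = 1 / 2 :> R by lra.
  by rewrite invf_div divr1.
(* Reindex the upper half by k |-> 2N - k. *)
rewrite -{1}[N.+1]add1n big_addn -addnn addnK [X in _ + (_ + X)]big_nat_rev/=.
rewrite addrCA -big_split addrC; congr (_ + _).
rewrite mulr_sumr; apply: eq_big_nat => k /andP[k0 kN]; rewrite /= addnn.
have kN2 : (0 < k < N.*2)%N by rewrite k0 -addnn ltn_addr.
have -> : k%:R * (pi / 2) / N%:R = (k%:R * (pi / 2) / N.*2%:R) *+ 2 :> R.
  by rewrite N2; field.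
have xI := @grid_bounds R _ _ kN2; have /andP[x0 xpi] := xI.
have -> : (1 + N - k.+1 + N)%:R * (pi / 2) / N.*2%:R
    = - (k%:R * (pi / 2) / N.*2%:R - pi / 2) :> R.
  by rewrite add1n subSS natrD natrB ?(ltnW kN)// N2; field.
rewrite sinN sinBpihalf opprK inv_sqr_sin_half// gt_eqF//.
  exact: sin_gt0_pihalf.
by apply: cos_gt0_pihalf; have := pi_gt0 R; lra.
Qed.

Lemma inv_sqr_sin_sum_pow2 (R : realType) (n : nat) :
  inv_sqr_sin_sum R (2 ^ n) = 2 / 3 * ((2 ^ n)%:R ^+ 2 - 1).
Proof.
elim: n => [|n IH]; first by rewrite /inv_sqr_sin_sum big_geq// expr1n subrr mulr0.
by rewrite expnS mul2n inv_sqr_sin_sum_double ?expn_gt0// IH -mul2n natrM; field.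
Qed.

Definition zeta2_sum (R : realType) (m : nat) : R :=
  \sum_(1 <= d < m.+1) d%:R ^- 2.

(** Summing [inv_sqr_sin_bounds] over the grid $k\pi/2N$ and scaling by
$(\pi/2N)^2$ turns the terms $x^{-2}$ into $k^{-2}$; the slack $1$ in each of the
fewer than $N$ terms costs at most $N (\pi/2N)^2 = \pi^2/4N$. *)
Lemma zeta2_sum_sandwich (R : realType) (n : nat) (N := ((2 ^ n)%:R : R)) :
  zeta2_sum R (2 ^ n).-1 <= pi ^+ 2 / 6 * (1 - N ^- 2)
    <= zeta2_sum R (2 ^ n).-1 + pi ^+ 2 / (4 * N).
Proof.
set M := (2 ^ n)%N in N *.
have M0 : (0 < M)%N by rewrite expn_gt0.
have N0 : 0 < N by rewrite ltr0n.
have pi0 := pi_gt0 R.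
have HE : (pi / 2 / N) ^+ 2 * inv_sqr_sin_sum R M = pi ^+ 2 / 6 * (1 - N ^- 2).
  by rewrite inv_sqr_sin_sum_pow2 -/M -/N; field; rewrite gt_eqF.
have term k : (0 < k < M)%N ->
    k%:R ^- 2 <= (pi / 2 / N) ^+ 2 * (sin (k%:R * (pi / 2) / N)) ^- 2
      <= k%:R ^- 2 + (pi / 2 / N) ^+ 2.
  move=> kM; have /andP[lo hi] := @inv_sqr_sin_bounds R _ (@grid_bounds R _ _ kM).
  have c0 : 0 < (pi / 2 / N) ^+ 2 by rewrite exprn_gt0// !divr_gt0.
  have <- : (pi / 2 / N) ^+ 2 * (k%:R * (pi / 2) / N) ^- 2 = k%:R ^- 2.
    have k0 : 0 < k%:R :> R by rewrite ltr0n; case/andP: kM.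
    by move: (@pi R) pi0 => c c_gt0; field; rewrite !gt_eqF.
  by rewrite -[X in _ <= _ <= _ + X]mulr1 -mulrDr !ler_pM2l// lo.
rewrite -HE /zeta2_sum (prednK M0) /inv_sqr_sin_sum -/N mulr_sumr; apply/andP; split.
  by apply: ler_sum_nat => k /term /andP[].
apply: (@le_trans _ _ (\sum_(1 <= k < M) (k%:R ^- 2 + (pi / 2 / N) ^+ 2))).
  by apply: ler_sum_nat => k /term /andP[].
rewrite big_split/= lerD2l sumr_const_nat -[_ *+ (M - 1)]mulr_natr natrB//.
have -> : pi ^+ 2 / (4 * N) = (pi / 2 / N) ^+ 2 * N by field; rewrite gt_eqF.
by rewrite ler_wpM2l ?sqr_ge0// gerBl.
Qed.

(** The tail is bounded by telescoping: $1/(n+1)^2 \le 1/n - 1/(n+1)$, so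
$\sum_{d \le n} d^{-2} + 1/n$ is nonincreasing. *)
Lemma zeta2_sum_tail (R : realType) (m n : nat) : (0 < m <= n)%N ->
  zeta2_sum R n + n%:R^-1 <= zeta2_sum R m + m%:R^-1.
Proof.
case/andP=> m0; elim: n => [|n IH]; first by rewrite leqn0 => /eqP ->.
rewrite leq_eqVlt => /predU1P[->//|]; rewrite ltnS => mn.
apply: le_trans (IH mn); rewrite /zeta2_sum big_nat_recr//= -addrA lerD2l.
have n0 : 0 < n%:R :> R by rewrite ltr0n (leq_trans m0).
have -> : n%:R^-1 = n.+1%:R ^- 2 + n.+1%:R^-1 + (n%:R * n.+1%:R ^+ 2)^-1 :> R.
  by rewrite -natr1; field; rewrite !gt_eqF// addr_gt0.
by rewrite lerDl invr_ge0 mulr_ge0// ltW.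
Qed.

Lemma zeta2_sum_incr (R : realType) : {homo zeta2_sum R : m n / (m <= n)%N >-> m <= n}.
Proof.
move=> m n mn; rewrite /zeta2_sum (@big_cat_nat _ _ _ m.+1 1 n.+1)//= lerDl.
by apply: sumr_ge0 => k _; rewrite invr_ge0 exprn_ge0.
Qed.

(** A quantitative form of $\zeta(2) = \pi^2/6$, with the rate $1/m$. Both sides
come from [zeta2_sum_sandwich] at $N = 2^n$: the lower one directly, by
monotonicity; the upper one after [zeta2_sum_tail], letting $n$ go to infinity. *)
Lemma zeta2_sum_basel (R : realType) (m : nat) : (0 < m)%N ->
  zeta2_sum R m <= pi ^+ 2 / 6 <= zeta2_sum R m + m%:R^-1.
Proof.
move=> m0; have pi0 : 0 < pi ^+ 2 :> R by rewrite exprn_gt0// pi_gt0.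
have large n : (m <= n)%N -> (m <= (2 ^ n).-1)%N.
  by move=> mn; rewrite -ltnS prednK ?expn_gt0// (leq_ltn_trans mn)// ltn_expl.
apply/andP; split.
  apply: (le_trans (zeta2_sum_incr R _ _ (large _ (leqnn m)))).
  have /andP[/le_trans + _] := zeta2_sum_sandwich R m; apply.
  by rewrite ler_piMr ?divr_ge0 ?(ltW pi0)// gerBl invr_ge0 exprn_ge0.
have key n : (m <= n)%N ->
    pi ^+ 2 / 6 <= zeta2_sum R m + m%:R^-1 + pi ^+ 2 / (2 ^ n)%:R.
  move=> /large mn; have /andP[_ hi] := zeta2_sum_sandwich R n.
  have mn0 : (0 < m <= (2 ^ n).-1)%N by rewrite m0.
  have tail := @zeta2_sum_tail R _ _ mn0.
  have M0 : 0 <= (2 ^ n).-1%:R^-1 :> R by rewrite invr_ge0.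
  set N := (2 ^ n)%:R in hi *.
  have N1 : 1 <= N by rewrite ler1n expn_gt0.
  have N0 : 0 < N by rewrite (lt_le_trans ltr01).
  have NV : N ^- 2 <= N^-1 by rewrite lef_pV2 ?posrE ?exprn_gt0// ler_eXnr.
  have := ler_wpM2l (ltW pi0) NV.
  have NV0 : 0 < pi ^+ 2 * N^-1 by rewrite mulr_gt0// invr_gt0.
  have E4 : pi ^+ 2 / (4 * N) = pi ^+ 2 * N^-1 / 4 by field; rewrite gt_eqF.
  by lra.
(* If the bound failed by d > 0, then pi^2/2^n would be at least d for all n >= m. *)
rewrite leNgt; apply/negP => lt.
set b := zeta2_sum R m + m%:R^-1 in lt key.
have d0 : 0 < pi ^+ 2 / 6 - b by rewrite subr_gt0.
set n := maxn m (Num.truncn (pi ^+ 2 / (pi ^+ 2 / 6 - b))).+1.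
have := key n (leq_maxl _ _); rewrite -lerBlDl leNgt => /negP; apply.
rewrite ltr_pdivrMr ?ltr0n ?expn_gt0// mulrC -ltr_pdivrMr//.
rewrite (lt_le_trans (truncnS_gt _))// ler_nat.
by rewrite (leq_trans (leq_maxr m _))// ltnW// ltn_expl.
Qed.

(** * Errors of order o(m^2) and the contraction principle *)

(** This is $f(m) \le o(m^2)$ together with $f(0) \le 0$. The linear term replaces
the usual restriction to large $m$: the bound then holds for every $m$, and can be
summed over all the arguments $\lfloor m/d \rfloor$, small ones included. *)
Definition subquadratic (R : realType) (f : nat -> R) : Prop :=
  forall eta, 0 < eta -> exists C, forall m, f m <= eta * m%:R ^+ 2 + C * m%:R.

Definition harmonic_sum (R : realType) (m : nat) : R :=
  \sum_(1 <= d < m.+1) d%:R^-1.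

Lemma subquadratic_add (R : realType) (f g : nat -> R) :
  subquadratic R f -> subquadratic R g -> subquadratic R (fun m => f m + g m).
Proof.
move=> sf sg eta eta0; have e2 : 0 < eta / 2 by rewrite divr_gt0.
have [C fC] := sf _ e2; have [D gD] := sg _ e2; exists (C + D) => m.
by have := fC m; have := gD m; lra.
Qed.

Lemma subquadratic_scale (R : realType) (c : R) (f : nat -> R) : 0 <= c ->
  subquadratic R f -> subquadratic R (fun m => c * f m).
Proof.
move=> c0 sf eta eta0; have c1 : 0 < c + 1 by lra.
have [|C fC] := sf (eta / (c + 1)); first by rewrite divr_gt0.
exists (c * C) => m; apply: (le_trans (ler_wpM2l c0 (fC m))).
rewrite mulrDr -(mulrA c C) lerD2r mulrA ler_wpM2r ?exprn_ge0// mulrA.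
by rewrite ler_pdivrMr//; lra.
Qed.

Lemma subquadratic_le (R : realType) (f g : nat -> R) :
  (forall m, f m <= g m) -> subquadratic R g -> subquadratic R f.
Proof.
move=> fg sg eta eta0; have [C gC] := sg _ eta0; exists C => m.
exact: le_trans (fg m) (gC m).
Qed.

Lemma subquadratic_linear (R : realType) (c : R) : subquadratic R (fun m => c * m%:R).
Proof.
move=> eta eta0; exists c => m; rewrite lerDr mulr_ge0 ?exprn_ge0//; exact: ltW.
Qed.

Lemma harmonic_sum_ge0 (R : realType) (m : nat) : 0 <= harmonic_sum R m.
Proof. by apply: sumr_ge0 => d _; rewrite invr_ge0. Qed.

(** The terms $1/d$ with $d > 1/\eta$ are below $\eta$, so
$H_m \le \eta m + H_N$ with $N > 1/\eta$ fixed. *)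
Lemma subquadratic_harmonic (R : realType) :
  subquadratic R (fun m => m%:R * harmonic_sum R m).
Proof.
move=> eta eta0; set N := (Num.truncn eta^-1).+1.
exists (harmonic_sum R N) => m.
suff : harmonic_sum R m <= eta * m%:R + harmonic_sum R N.
  have m0 := ler0n R m; move=> /(ler_wpM2l m0) /le_trans; apply.
  by rewrite le_eqVlt; apply/orP; left; apply/eqP; ring.
have [mN|/ltnW Nm] := leqP m N.
  rewrite ler_wpDl ?mulr_ge0 ?(ltW eta0)// /harmonic_sum.
  rewrite (@big_cat_nat _ _ _ m.+1 1 N.+1)//= lerDl.
  by apply: sumr_ge0 => d _; rewrite invr_ge0.
rewrite /harmonic_sum (@big_cat_nat _ _ _ N.+1 1 m.+1)//= addrC lerD2r.
apply: (@le_trans _ _ (\sum_(N.+1 <= d < m.+1) eta)).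
  apply: ler_sum_nat => d /andP[Nd _].
  rewrite -[eta]invrK lef_pV2 ?posrE ?invr_gt0// ?ltr0n ?(leq_trans _ Nd)//.
  rewrite (le_trans (ltW (truncnS_gt _)))// ler_nat; exact: ltnW.
rewrite sumr_const_nat -[_ *+ _]mulr_natr ler_wpM2l ?(ltW eta0)// ler_nat subSS.
exact: leq_subr.
Qed.

Lemma floor_ratio (R : realType) (m d : nat) : (0 < d)%N ->
  (m %/ d)%:R <= (m%:R / d%:R : R) <= (m %/ d)%:R + 1.
Proof.
move=> d0; have dR : 0 < d%:R :> R by rewrite ltr0n.
rewrite ler_pdivlMr// ler_pdivrMr// -natrM ler_nat leq_divM/=.
by rewrite natr1 -natrM ler_nat ltnW// ltn_ceil.
Qed.

(** The comparison with $1 + 1/4$ and the tail bound $1/2$ after it suffices: what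
matters is that $\zeta(2) - 1 \le 3/4$ is less than $1$. *)
Lemma zeta2_sum_le (R : realType) (m : nat) : zeta2_sum R m <= 7 / 4.
Proof.
case: m => [|[|m]].
- by rewrite /zeta2_sum big_geq//; lra.
- by rewrite /zeta2_sum big_nat1 expr1n invr1; lra.
have tail := @zeta2_sum_tail R 2 m.+2 isT.
have z2 : zeta2_sum R 2 = 1 + 1 / 4.
  by rewrite /zeta2_sum big_nat_recr//= big_nat1; field.
have : 0 <= m.+2%:R^-1 :> R by rewrite invr_ge0.
by move: (m.+2%:R^-1) tail => t; rewrite z2; lra.
Qed.

(** Substituting $w(q) \le A q^2 + C q$ with $q \le m/d$ in the recurrence gives
$w(m) \le r(m) + (\zeta(2) - 1) A m^2 + C m H_m$. The last term is again
subquadratic, so the coefficient of $m^2$ drops from $A$ to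
$\frac34 A + \frac18 A = \frac78 A$; iterating makes it arbitrarily small. *)
Lemma subquadratic_contraction (R : realType) (w r : nat -> R) (M : R) :
  (forall m, 0 <= w m) -> (forall m, w m <= M * m%:R ^+ 2) -> subquadratic R r ->
  (forall m, w m <= r m + \sum_(2 <= d < m.+1) w (m %/ d)%N) ->
  subquadratic R w.
Proof.
move=> w0 wM sr rec.
pose P A := exists C, forall m, w m <= A * m%:R ^+ 2 + C * m%:R.
have improve A : 0 < A -> P A -> P (7 / 8 * A).
  move=> A0 [C0 wC0].
  (* A nonnegative C is needed to compare C q with C m / d. *)
  pose C := Num.max C0 0.
  have C_ge0 : 0 <= C by rewrite le_max lexx orbT.
  have wC m : w m <= A * m%:R ^+ 2 + C * m%:R.
    by rewrite (le_trans (wC0 m))// lerD2l ler_wpM2r// le_max lexx.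
  have A8 : 0 < A / 8 by rewrite divr_gt0.
  have /(_ _ A8) [D rD] := subquadratic_add _ _ _ sr
    (subquadratic_scale _ _ _ C_ge0 (subquadratic_harmonic R)).
  exists D => m; case: m => [|m].
    by have := wM 0%N; rewrite !expr0n/= !mulr0 addr0.
  set x := m.+1%:R : R; have x0 : 0 <= x by [].
  have sumle : \sum_(2 <= d < m.+2) w (m.+1 %/ d)%N
      <= A * x ^+ 2 * (3 / 4) + C * (x * harmonic_sum R m.+1).
    have -> : A * x ^+ 2 * (3 / 4) = A * x ^+ 2 * (7 / 4 - 1) by field.
    apply: (@le_trans _ _ (A * x ^+ 2 * \sum_(2 <= d < m.+2) d%:R ^- 2
      + C * (x * \sum_(2 <= d < m.+2) d%:R^-1))).
      rewrite !mulr_sumr -big_split/=; apply: ler_sum_nat => d /andP[d2 _].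
      have d0 : (0 < d)%N by rewrite (leq_trans _ d2).
      have /andP[q _] := @floor_ratio R m.+1 _ d0.
      apply: (le_trans (wC _)); apply: lerD; last by rewrite ler_wpM2l.
      by rewrite -mulrA ler_wpM2l ?(ltW A0)// -expr_div_n lerXn2r// nnegrE ?divr_ge0.
    have zE : zeta2_sum R m.+1 = 1 + \sum_(2 <= d < m.+2) d%:R ^- 2.
      by rewrite /zeta2_sum big_ltn//= expr1n invr1.
    have hE : harmonic_sum R m.+1 = 1 + \sum_(2 <= d < m.+2) d%:R^-1.
      by rewrite /harmonic_sum big_ltn//= invr1.
    rewrite hE lerD//.
      by rewrite ler_wpM2l ?mulr_ge0 ?exprn_ge0 ?(ltW A0)//; have := zeta2_sum_le R m.+1; lra.
    by rewrite !ler_wpM2l// lerDr.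
  by have := rec m.+1; have := rD m.+1; rewrite -/x; lra.
move=> eta eta0.
pose M1 := Num.max M 1.
have M1_gt0 : 0 < M1 by rewrite lt_max ltr01 orbT.
have Pk k : P ((7 / 8) ^+ k * M1).
  elim: k => [|k IH].
    exists 0 => m; rewrite expr0 mul1r mul0r addr0 (le_trans (wM m))//.
    by rewrite ler_wpM2r ?exprn_ge0// le_max lexx.
  by rewrite exprS -mulrA; apply: improve => //; rewrite mulr_gt0// exprn_gt0 ?divr_gt0.
have [k kE] : exists k, (7 / 8) ^+ k * M1 <= eta.
  have /cvg_expr/cvgrPdist_le/(_ (eta / M1)) : `|7 / 8 : R| < 1 by rewrite gtr0_norm ?divr_gt0//; lra.
  case=> [|k _ /(_ _ (leqnn k))]; first by rewrite divr_gt0.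
  by rewrite /= sub0r normrN ger0_norm ?exprn_ge0 ?divr_ge0// ler_pdivlMr// => ?; exists k.
have [C wC] := Pk k; exists C => m; apply: (le_trans (wC m)).
by rewrite lerD2r ler_wpM2r// exprn_ge0.
Qed.

Lemma cvg_subquadratic (R : realType) (f : nat -> R) (l : R) :
  subquadratic R (fun m => `|f m - l * m%:R ^+ 2|) ->
  (f m / m%:R ^+ 2) @[m --> \oo] --> l.
Proof.
move=> sf; apply/cvgrPdist_le => e e0.
have e2 : 0 < e / 2 by rewrite divr_gt0.
have [C fC] := sf _ e2.
near=> m.
have m0 : 0 < m%:R :> R by rewrite ltr0n; near: m; exact: nbhs_infty_gt.
have Cm : C <= e / 2 * m%:R.
  rewrite mulrC -ler_pdivrMr//; near: m; exact: nbhs_infty_ger.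
have m20 : 0 < m%:R ^+ 2 :> R by rewrite exprn_gt0.
have -> : l - f m / m%:R ^+ 2 = - (f m - l * m%:R ^+ 2) / m%:R ^+ 2.
  by field; rewrite gt_eqF.
rewrite normrM normrN normfV (gtr0_norm m20) ler_pdivrMr//.
apply: (le_trans (fC m)).
by have := ler_wpM2r (ltW m0) Cm; lra.
Unshelve. all: by end_near. Qed.

(** * Asymptotics of the summatory totient *)

(** With $t = m/d$ and $q = \lfloor t \rfloor$ this is
$t^2 - q^2 = (t - q)(t + q) \le 1 \cdot 2t$. *)
Lemma floor_sqr_bounds (R : realType) (m d : nat) : (0 < d)%N ->
  0 <= (m%:R ^+ 2 * d%:R ^- 2 - (m %/ d)%:R ^+ 2 : R) <= 2 * (m%:R * d%:R^-1).
Proof.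
move=> d0; have /andP[lo hi] := @floor_ratio R m _ d0.
rewrite -expr_div_n; move: (_ / _) lo hi => t lo hi.
have q0 : 0 <= (m %/ d)%:R :> R by [].
rewrite subr_ge0 lerXn2r ?nnegrE ?(le_trans q0 lo)//= subr_sqr.
have : (t - (m %/ d)%:R) * (t + (m %/ d)%:R) <= 1 * (t + t).
  by apply: ler_pM; lra.
lra.
Qed.

(** Replacing each $\lfloor m/d \rfloor^2$ by $(m/d)^2$ costs at most $2 m H_m$, and
replacing $\sum_{d \le m} d^{-2}$ by $\pi^2/6$ costs at most $m^2 \cdot 1/m$. *)
Lemma sum_floor_sqr (R : realType) : subquadratic R (fun m =>
  `|\sum_(1 <= d < m.+1) (m %/ d)%:R ^+ 2 - pi ^+ 2 / 6 * m%:R ^+ 2|).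
Proof.
apply: (@subquadratic_le _ _ (fun m => 2 * (m%:R * harmonic_sum R m) + 1 * m%:R)).
  case=> [|m].
    by rewrite big_geq// expr0n/= !(mulr0, mul0r) subrr normr0 addr0.
  set x := m.+1%:R : R; have x0 : 0 < x by [].
  have /andP[zlo zhi] := @zeta2_sum_basel R m.+1 isT.
  have : 0 <= x ^+ 2 * zeta2_sum R m.+1 - \sum_(1 <= d < m.+2) (m.+1 %/ d)%:R ^+ 2
      <= 2 * (x * harmonic_sum R m.+1).
    rewrite /zeta2_sum /harmonic_sum !mulr_sumr -sumrB; apply/andP; split.
      rewrite big_nat; apply: sumr_ge0 => d /andP[d0 _].
      by have /andP[] := @floor_sqr_bounds R m.+1 d d0.
    apply: ler_sum_nat => d /andP[d0 _].
    by have /andP[] := @floor_sqr_bounds R m.+1 d d0.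
  have xx : x ^+ 2 * x^-1 = x by field; rewrite gt_eqF.
  have := ler_wpM2l (exprn_ge0 2 (ltW x0)) zlo.
  have := ler_wpM2l (exprn_ge0 2 (ltW x0)) zhi.
  rewrite mulrDr xx.
  have := harmonic_sum_ge0 R m.+1; rewrite ler_norml; lra.
apply: subquadratic_add; last exact: subquadratic_linear.
by apply: subquadratic_scale => //; exact: subquadratic_harmonic.
Qed.

Lemma totient_sum_bound (R : realType) (p m : nat) (c : R) : 0 <= c ->
  `|(totient_sum p m)%:R - c * m%:R ^+ 2| <= (p%:R + c) * m%:R ^+ 2.
Proof.
move=> c0; have s0 : 0 <= (totient_sum p m)%:R :> R by [].
have : (totient_sum p m)%:R <= p%:R * m%:R ^+ 2 :> R.
  by rewrite -natrX -natrM ler_nat totient_sum_le.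
have : 0 <= c * m%:R ^+ 2 by rewrite mulr_ge0 ?exprn_ge0.
have : 0 <= p%:R * m%:R ^+ 2 :> R by rewrite mulr_ge0 ?exprn_ge0.
rewrite ler_norml; lra.
Qed.

Lemma natr_sum_id (R : realType) (m : nat) :
  (\sum_(1 <= n < m.+1) n)%:R = (m%:R ^+ 2 + m%:R) / 2 :> R.
Proof.
elim: m => [|m IH]; first by rewrite big_geq// expr0n/= addr0 mul0r.
by rewrite big_nat_recr//= natrD IH -natr1; field.
Qed.

(** Subtracting $L \sum_d \lfloor m/d \rfloor^2$ from [totient_sum_floor], with
$L = 3/\pi^2$, gives the recurrence for the error; its inhomogeneous term is
subquadratic because $L \pi^2/6 = 1/2$ cancels the main term of $m(m+1)/2$. *)
Lemma totient_sum1_asymp (R : realType) : subquadratic R (fun m =>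
  `|(totient_sum 1 m)%:R - 3 / pi ^+ 2 * m%:R ^+ 2|).
Proof.
set c := 3 / pi ^+ 2.
have pi0 : pi ^+ 2 != 0 :> R by rewrite gt_eqF// exprn_gt0// pi_gt0.
have c0 : 0 <= c by rewrite divr_ge0// exprn_ge0// pi_ge0.
apply: (@subquadratic_contraction _ _ (fun m => 2^-1 * m%:R + c *
  `|\sum_(1 <= d < m.+1) (m %/ d)%:R ^+ 2 - pi ^+ 2 / 6 * m%:R ^+ 2|)) => //.
- by move=> m; exact: totient_sum_bound.
- apply: subquadratic_add; first exact: subquadratic_linear.
  by apply: subquadratic_scale => //; exact: sum_floor_sqr.
case=> [|m].
  by rewrite /totient_sum !big_geq// expr0n/= !mulr0 subrr normr0 mulr0 !addr0.
set x := m.+1%:R : R.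
have gauss : \sum_(1 <= d < m.+2) (totient_sum 1 (m.+1 %/ d))%:R = (x ^+ 2 + x) / 2.
  by rewrite -natr_sum totient_sum_floor natr_sum_id.
rewrite /= -/x; set Q := \sum_(1 <= d < m.+2) (m.+1 %/ d)%:R ^+ 2 : R.
have err : \sum_(1 <= d < m.+2) ((totient_sum 1 (m.+1 %/ d))%:R - c * (m.+1 %/ d)%:R ^+ 2)
    = 2^-1 * x - c * (Q - pi ^+ 2 / 6 * x ^+ 2).
  rewrite sumrB gauss -mulr_sumr -/Q /c; move: Q => Q'.
  by move: (pi ^+ 2) pi0 => t t0; field.
rewrite big_ltn//= divn1 in err; rewrite (canRL (addrK _) err).
apply: (le_trans (ler_normB _ _)); apply: lerD; last exact: ler_norm_sum.
apply: (le_trans (ler_normB _ _)); rewrite [`|c * _|]normrM (ger0_norm c0) lerD2r.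
by rewrite ger0_norm// mulr_ge0.
Qed.

(** The constant $G = 3p^2/((p+1)\pi^2)$ is the solution of
$G = (p-1) \cdot 3/\pi^2 + G/p^2$, so that the main terms of [totient_sum_prime]
cancel up to the rounding error $G ((m/p)^2 - \lfloor m/p \rfloor^2)$. *)
Lemma totient_sum_asymp (R : realType) (p : nat) : prime p ->
  subquadratic R (fun m =>
  `|(totient_sum p m)%:R - 3 * p%:R ^+ 2 / ((p%:R + 1) * pi ^+ 2) * m%:R ^+ 2|).
Proof.
move=> pp; set G := _ / _.
have p0 : 0 < p%:R :> R by rewrite ltr0n prime_gt0.
have p1 : 0 < p%:R + 1 :> R by rewrite addr_gt0.
have pi0 : 0 < pi ^+ 2 :> R by rewrite exprn_gt0// pi_gt0.
have G0 : 0 <= G by rewrite divr_ge0 ?mulr_ge0 ?exprn_ge0 ?pi_ge0// ltW.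
have GE : G = p.-1%:R * (3 / pi ^+ 2) + G * p%:R ^- 2.
  rewrite -subn1 natrB ?prime_gt0// /G.
  by move: (pi ^+ 2) pi0 => t t0; field; rewrite !gt_eqF.
pose w m := `|(totient_sum p m)%:R - G * m%:R ^+ 2|.
have w0 m : 0 <= w m by exact: normr_ge0.
apply: (@subquadratic_contraction _ w (fun m => p.-1%:R *
    `|(totient_sum 1 m)%:R - 3 / pi ^+ 2 * m%:R ^+ 2|
    + (G * (2 * p%:R^-1)) * m%:R)) => //.
- by move=> m; exact: totient_sum_bound.
- apply: subquadratic_add; last exact: subquadratic_linear.
  by apply: subquadratic_scale => //; exact: totient_sum1_asymp.
move=> m; apply: (@le_trans _ _ (p.-1%:R *
    `|(totient_sum 1 m)%:R - 3 / pi ^+ 2 * m%:R ^+ 2|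
    + (G * (2 * p%:R^-1)) * m%:R + w (m %/ p)%N)).
  rewrite [w m]/w totient_sum_prime// natrD natrM.
  have /andP[lo hi] := @floor_sqr_bounds R m p (prime_gt0 pp).
  set D := m%:R ^+ 2 * p%:R ^- 2 - (m %/ p)%:R ^+ 2 in lo hi.
  have -> : p.-1%:R * (totient_sum 1 m)%:R + (totient_sum p (m %/ p))%:R - G * m%:R ^+ 2
      = p.-1%:R * ((totient_sum 1 m)%:R - 3 / pi ^+ 2 * m%:R ^+ 2)
        - G * D + ((totient_sum p (m %/ p))%:R - G * (m %/ p)%:R ^+ 2) :> R.
    by rewrite [in LHS]GE /D; ring.
  apply: (le_trans (ler_normD _ _)); rewrite lerD2r.
  apply: (le_trans (ler_normB _ _)); rewrite [`|p.-1%:R * _|]normrM.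
  rewrite [`|G * D|]normrM (ger0_norm G0) (ger0_norm lo) ger0_norm// lerD2l.
  by rewrite -mulrA ler_wpM2l//; lra.
(* The single term at d = p is one of those of the sum, unless m < p, when it
   vanishes. *)
rewrite lerD2l; have [pm|mp] := leqP p m.
  rewrite (bigD1_seq p) ?iota_uniq ?mem_index_iota ?ltnS ?pm ?prime_gt1//= lerDl.
  by apply: sumr_ge0.
rewrite divn_small//; have -> : w 0%N = 0.
  by rewrite /w /totient_sum big_geq// expr0n mulr0 subrr normr0.
by apply: sumr_ge0.
Qed.

Theorem theorem1 (R : realType) (p : nat) (hp : prime p) :
  ((\sum_(1 <= k < m.+1) (totient (p * k)%N)%:R) / (p%:R * m%:R) ^+ 2 : R)
    @[m --> \oo] --> (3 / ((p%:R + 1) * pi ^+ 2) : R).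
Proof.
have p0 : 0 < p%:R :> R by rewrite ltr0n prime_gt0.
have p1 : 0 < p%:R + 1 :> R by rewrite addr_gt0.
have pi0 : 0 < pi ^+ 2 :> R by rewrite exprn_gt0// pi_gt0.
have ratioE m : (\sum_(1 <= k < m.+1) (totient (p * k)%N)%:R) / (p%:R * m%:R) ^+ 2
    = (totient_sum p m)%:R / m%:R ^+ 2 * p%:R ^- 2 :> R.
  by rewrite -natr_sum -mulrA -invfM -exprMn [m%:R * _]mulrC.
have -> : 3 / ((p%:R + 1) * pi ^+ 2)
    = 3 * p%:R ^+ 2 / ((p%:R + 1) * pi ^+ 2) * p%:R ^- 2 :> R.
  by move: (pi ^+ 2) pi0 => t t0; field; rewrite !gt_eqF.
under eq_fun do rewrite ratioE.
apply: cvgM; last exact: cvg_cst.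
by apply: cvg_subquadratic; exact: totient_sum_asymp.
Qed.
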